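(* For all real numbers $0<a\le b$ and $c>0$ there is a constant $C_0=C_0(a,b,c)$ such that the following holds. Let $m,n\ge 1$, let $X_0\in\mathbb{R}^{m\times n}$ be a rank-one matrix with $a\le|(X_0)_{ij}|\le b$ for all $i,j$, let $\Omega\subseteq\{1,\dots,m\}\times\{1,\dots,n\}$ be such that the bipartite graph $\mathcal{G}$ associated with $\Omega$ is connected, let $\varepsilon=(\varepsilon_{ij})_{(i,j)\in\Omega}$ be an arbitrary real vector with $\|\varepsilon\|_2=\sqrt{\sum_{(i,j)\in\Omega}\varepsilon_{ij}^2}$, and let $\eta\geq 0$ be an admissible noise level with constant $c$. Let $M$ be any optimal solution of the semidefinite program $$\min_M\ \operatorname{Tr}(M)\quad\text{subject to}\quad M\succeq 0,\quad M\ \text{is a structured moment matrix with } M_{0,0}=1,\quad \Big(\sum_{|\kappa|\le 2}\ \sum_{(i,j)\in\Omega}\big|L_M(\tilde h_{ij}\,z^\kappa)\big|^2\Big)^{1/2}\le\eta .$$ Then $$\frac{\|M-M_0\|_F}{\|M_0\|_F}\le C_0\,(m+n)^{7/2}\,\|\varepsilon\|_2 .$$ (In particular $C_0$ does not depend on $\Omega$, $m$, $n$ or $\varepsilon$.)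
   Context: Bipartite graph: $\mathcal{G}$ has vertex set consisting of the $m$ row indices and the $n$ column indices, with an edge between row $i$ and column $j$ iff $(i,j)\in\Omega$. Normalization: write $X_0=x_0y_0^T$ with $(x_0)_1=1$. Let $K=m+n-1$ and consider the variables $z=(x_2,\dots,x_m,y_1,\dots,y_n)\in\mathbb{R}^K$, with $z_0=((x_0)_2,\dots,(x_0)_m,(y_0)_1,\dots,(y_0)_n)$. For $\alpha\in\mathbb{N}^K$ write $z^\alpha=\prod_k z_k^{\alpha_k}$, $|\alpha|=\sum_k\alpha_k$, and $\mathbb{N}^K_2=\{\alpha\in\mathbb{N}^K:|\alpha|\le 2\}$. Noisy constraint polynomials: for $(i,j)\in\Omega$, $\tilde h_{ij}(z)=y_j-(X_0)_{1j}-\varepsilon_{1j}$ if $i=1$, and $\tilde h_{ij}(z)=x_iy_j-(X_0)_{ij}-\varepsilon_{ij}$ if $i\ge 2$. Moment matrices: $M$ ranges over real symmetric matrices with rows and columns indexed by $\mathbb{N}^K_2$. $M$ is a structured moment matrix if $M_{\alpha,\beta}=M_{\alpha',\beta'}$ whenever $\alpha+\beta=\alpha'+\beta'$; for $|\gamma|\le 4$ the common value of $M_{\alpha,\beta}$ with $\alpha+\beta=\gamma$ is denoted $m_\gamma$, and for a polynomial $p(z)=\sum_{|\gamma|\le 4}p_\gamma z^\gamma$ we put $L_M(p)=\sum_\gamma p_\gamma m_\gamma$. Finally $m_0=(z_0^\alpha)_{\alpha\in\mathbb{N}^K_2}$ and $M_0=m_0m_0^T$; $\|\cdot\|_F$ is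 the Frobenius norm. Admissible noise level with constant $c$: $\eta$ satisfies (i) $\eta\ge\|\varepsilon\|_2\sqrt{1+\|z_0\|_1^2}$; (ii) $\eta$ bounds the weighted residuals of $M_0$, i.e. $\sum_{|\kappa|\le 2}\sum_{(i,j)\in\Omega}(\varepsilon_{ij}z_0^\kappa)^2\le\eta^2$; (iii) $\eta\le c\,(m+n)\,\|\varepsilon\|_2$. *)

(* Defs.v *)
From HB Require Import structures.
From mathcomp Require Export all_boot all_order all_algebra.
From mathcomp Require Export reals.
From mathcomp Require Export mpoly.

#[export] Set Implicit Arguments.
#[export] Unset Strict Implicit.
#[export] Unset Printing Implicit Defensive.

Import Order.TTheory GRing.Theory Num.Theory.
Local Open Scope ring_scope.

(* An m x n problem is represented with m.+1 rows and n.+1 columns, so that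
   K = (m.+1 + n.+1) - 1 = m + n.+1; x_2, ..., x_m come first among the
   variables and are the left summand of 'I_(m + n.+1). *)

Definition bip_edge (m n : nat) (Omega : {set 'I_m * 'I_n}) :
    rel ('I_m + 'I_n)%type :=
  fun u v => match u, v with
             | inl i, inr j => (i, j) \in Omega
             | inr j, inl i => (i, j) \in Omega
             | _, _ => false
             end.

Definition bip_connected (m n : nat) (Omega : {set 'I_m * 'I_n}) : Prop :=
  forall u v : ('I_m + 'I_n)%type, connect (bip_edge Omega) u v.

(* eps is a family indexed by Omega: its values outside Omega are never used. *)
Definition noise_norm (R : realType) (m n : nat) (Omega : {set 'I_m * 'I_n})
    (eps : 'I_m -> 'I_n -> R) : R :=
  Num.sqrt (\sum_(p in Omega) eps p.1 p.2 ^+ 2).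

Definition zvec (R : realType) (m n : nat) (x : 'cV[R]_m.+1) (y : 'cV[R]_n.+1) :
    'cV[R]_(m + n.+1) :=
  col_mx (row' ord0 x : 'cV_m) y.

Definition norm1 (R : realType) (K : nat) (z : 'cV[R]_K) : R :=
  \sum_k `|z k 0|.

Definition monom (R : realType) (K : nat) (z : 'cV[R]_K) (alpha : 'X_{1..K}) : R :=
  \prod_k z k 0 ^+ alpha k.

Definition hconstr (R : realType) (m n : nat) (X0 : 'M[R]_(m.+1, n.+1))
    (eps : 'I_m.+1 -> 'I_n.+1 -> R) (i : 'I_m.+1) (j : 'I_n.+1) :
    {mpoly R[m + n.+1]} :=
  match (unlift ord0 i : option 'I_m) with
  | None => 'X_(rshift m j) - (X0 i j)%:MP - (eps i j)%:MP
  | Some i' => 'X_(lshift n.+1 i') * 'X_(rshift m j)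
               - (X0 i j)%:MP - (eps i j)%:MP
  end.

(* 'X_{1..K < 3} is the set of multi-indices of degree at most 2;
   matrices indexed by it go through the enumeration of this finite type. *)
Notation mommx R K := 'M[R]_#|{: 'X_{1..K < 3}}|.

Definition ment (R : realType) (K : nat) (M : mommx R K)
    (alpha beta : 'X_{1..K < 3}) : R :=
  M (enum_rank alpha) (enum_rank beta).

Definition structured (R : realType) (K : nat) (M : mommx R K) : Prop :=
  forall alpha beta alpha' beta' : 'X_{1..K < 3},
    (alpha + beta)%MM = (alpha' + beta')%MM ->
    ment M alpha beta = ment M alpha' beta'.

(* m_gamma, read off an arbitrary entry (alpha, beta) with alpha + beta = gamma.
   Such an entry exists iff gamma has degree at most 4, and the choice does not
   matter when M is structured; the value is 0 in higher degrees. *)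
Definition moment (R : realType) (K : nat) (M : mommx R K)
    (gamma : 'X_{1..K}) : R :=
  if [pick p : 'X_{1..K < 3} * 'X_{1..K < 3} | (p.1 + p.2)%MM == gamma]
  is Some p then ment M p.1 p.2 else 0.

Definition riesz (R : realType) (K : nat) (M : mommx R K) (p : {mpoly R[K]}) : R :=
  \sum_(gamma <- msupp p) p@_gamma * moment M gamma.

Definition possemidef (R : realType) (N : nat) (A : 'M[R]_N) : Prop :=
  A^T = A /\ forall v : 'cV[R]_N, 0 <= (v^T *m A *m v) 0 0.

Definition frob (R : realType) (p q : nat) (A : 'M[R]_(p, q)) : R :=
  Num.sqrt (\sum_i \sum_j A i j ^+ 2).

Definition momvec (R : realType) (K : nat) (z : 'cV[R]_K) :
    'cV[R]_#|{: 'X_{1..K < 3}}| :=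
  \col_k monom z (enum_val k : 'X_{1..K < 3}).

Definition mom0 (R : realType) (K : nat) (z : 'cV[R]_K) : mommx R K :=
  momvec z *m (momvec z)^T.

Definition admissible (R : realType) (m n : nat)
    (Omega : {set 'I_m.+1 * 'I_n.+1}) (eps : 'I_m.+1 -> 'I_n.+1 -> R)
    (z0 : 'cV[R]_(m + n.+1)) (c eta : R) : Prop :=
  [/\ noise_norm Omega eps * Num.sqrt (1 + norm1 z0 ^+ 2) <= eta,
      \sum_(kappa : 'X_{1..(m + n.+1) < 3}) \sum_(p in Omega)
         (eps p.1 p.2 * monom z0 kappa) ^+ 2 <= eta ^+ 2
    & eta <= c * (m.+1 + n.+1)%:R * noise_norm Omega eps].

Definition feasible (R : realType) (m n : nat) (X0 : 'M[R]_(m.+1, n.+1))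
    (Omega : {set 'I_m.+1 * 'I_n.+1}) (eps : 'I_m.+1 -> 'I_n.+1 -> R)
    (eta : R) (M : mommx R (m + n.+1)) : Prop :=
  [/\ possemidef M,
      structured M,
      ment M bm0 bm0 = 1
    & Num.sqrt (\sum_(kappa : 'X_{1..(m + n.+1) < 3}) \sum_(p in Omega)
         `|riesz M (hconstr X0 eps p.1 p.2 * 'X_[kappa])| ^+ 2) <= eta].

Definition sdp_optimal (R : realType) (m n : nat) (X0 : 'M[R]_(m.+1, n.+1))
    (Omega : {set 'I_m.+1 * 'I_n.+1}) (eps : 'I_m.+1 -> 'I_n.+1 -> R)
    (eta : R) (M : mommx R (m + n.+1)) : Prop :=
  feasible X0 Omega eps eta M /\
  forall M' : mommx R (m + n.+1), feasible X0 Omega eps eta M' -> \tr M <= \tr M'.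

(* Main.v *)
Require Import Defs.
From mathcomp Require Import all_boot all_order all_algebra reals mpoly.
From mathcomp Require Import ring lra zify.

Import Order.TTheory GRing.Theory Num.Theory.
Local Open Scope ring_scope.

(** Write m_gamma for the moments of the optimal matrix M, N for the number of
    vertices of the bipartite graph, and delta = eta + |eps| T where T bounds the
    moments of degree at most 2. Row 1 carries the constant monomial 1 and every
    other vertex carries its own variable, so that for each edge uv the
    constraints read uniformly
      m(u + v + kappa) = z_u z_v m(kappa) + O(delta)   for |kappa| <= 2.

    Linear bound on the moments of degree at most 2 ([moment_error]). Two
    consecutive edges u - v - w give, for |q| <= 1, two expressions of
    m(u + v + w + q), and dividing by z_u z_v z_w yields
      m(w + q) / z_w = m(u + q) / z_u + O(delta).
    These errors add up along a path, so there is no exponential growth: starting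
    from row 1, connectedness gives m(w + q) = z_w m(q) + O(N delta) for every
    vertex w ([moment_walk]). Using this for q = 0 and then for q a vertex gives
    m(alpha) = z0^alpha + O(N delta) for |alpha| <= 2.

    From the first column to the whole matrix ([near_rank_one]). Let v be the
    column of M indexed by the multi-index 0 and w = m_0. As M_{0,0} = 1, the
    Schur complement M - v v^T is positive semidefinite, hence its Frobenius norm
    is at most its trace Tr M - |v|^2. The matrix M_0 is feasible
    ([feasible_mom0]), so optimality gives Tr M <= |w|^2, and this trace is at most
    |w|^2 - |v|^2 <= 2 <w, w - v>, which is linear in the error on the first
    column. Together with M - M_0 = (M - v v^T) + (v - w) v^T + w (v - w)^T this
    bounds |M - M_0| by a multiple of the error on the first column times the
    number of multi-indices, while |M_0| = |w|^2 is at least a multiple of that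
    number.

    Finally T = O(N) since m_kappa^2 <= Tr M <= |w|^2 = O(N^2), so delta is
    O(N |eps|) and the relative error is O(N^2 |eps|), which is more than enough. *)

(** * Positive semidefinite matrices close to rank one *)

Lemma frob_sqr (R : realType) (p q : nat) (A : 'M[R]_(p, q)) :
  frob A ^+ 2 = \sum_i \sum_j A i j ^+ 2.
Proof.
by rewrite sqr_sqrtr // sumr_ge0 // => i _; rewrite sumr_ge0 // => j _; rewrite sqr_ge0.
Qed.

Lemma frob_outer (R : realType) (N : nat) (w : 'cV[R]_N) :
  frob (w *m w^T) = \sum_k w k 0 ^+ 2.
Proof.
have W0 : 0 <= \sum_k w k 0 ^+ 2 by rewrite sumr_ge0 // => k _; rewrite sqr_ge0.
rewrite -[RHS]ger0_norm // -sqrtr_sqr /frob; congr Num.sqrt.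
rewrite expr2 mulr_suml; apply: eq_bigr => i _.
rewrite mulr_sumr; apply: eq_bigr => j _.
by rewrite mxE big_ord1 mxE exprMn.
Qed.

Lemma possemidef_outer (R : realType) (N : nat) (w : 'cV[R]_N) :
  possemidef (w *m w^T).
Proof.
split; first by rewrite trmx_mul trmxK.
move=> v; rewrite mulmxA -mulmxA.
have -> : w^T *m v = (v^T *m w)^T by rewrite trmx_mul trmxK.
by rewrite mxE big_ord1 [_^T _ _]mxE -expr2 sqr_ge0.
Qed.

Lemma possemidef_sqr_le (R : realType) (N : nat) (A : 'M[R]_N) i j :
  possemidef A -> A i j ^+ 2 <= A i i * A j j.
Proof.
case=> symA posA.
have Aji : A j i = A i j by rewrite -[in LHS]symA mxE.
have quad (s t : R) : 0 <= s ^+ 2 * A i i + 2%:R * (s * t * A i j) + t ^+ 2 * A j j.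
  have := posA (s *: delta_mx i 0 + t *: delta_mx j 0).
  rewrite mulmxDr [(_ + _)^T]linearD /= !linearZ /= !mulmxDl -!scalemxAl !trmx_delta.
  rewrite -!rowE -!colE !mxE Aji => h.
  by apply: le_trans h _; rewrite le_eqVlt; apply/orP; left; apply/eqP; ring.
have Ai0 : 0 <= A i i.
  by have := quad 1 0; rewrite !(mul0r, mulr0, expr0n, expr1n, mul1r, addr0).
have := quad (- A i j) (A i i).
have [Ai|Ai|Ai] := ltgtP (A i i) 0; first by lra.
  move=> q1; rewrite -subr_ge0 -(pmulr_rge0 _ Ai).
  by apply: le_trans q1 _; rewrite le_eqVlt; apply/orP; left; apply/eqP; ring.
move=> _; rewrite Ai mul0r.
have [->|nz] := eqVneq (A i j) 0; first by rewrite expr0n.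
(* here the form is linear in s: choose s making it equal to -1 *)
have := quad (- (A j j + 1) / (2%:R * A i j)) 1; rewrite Ai.
have -> : - (A j j + 1) / (2%:R * A i j) * 1 * A i j = - (A j j + 1) / 2%:R.
  by field.
by lra.
Qed.

Lemma possemidef_frob_le_tr (R : realType) (N : nat) (A : 'M[R]_N) :
  possemidef A -> frob A <= \tr A.
Proof.
move=> psdA.
have dA i : 0 <= A i i by have := psdA.2 (delta_mx i 0);
  rewrite trmx_delta -rowE -colE !mxE.
have tA : 0 <= \tr A by rewrite sumr_ge0.
rewrite -(ler_pXn2r (n := 2)) ?nnegrE ?sqrtr_ge0 // frob_sqr expr2.
rewrite {1}/mxtrace mulr_suml ler_sum // => i _; rewrite mulr_sumr ler_sum // => j _.
exact: possemidef_sqr_le.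
Qed.

(** The Schur complement of a diagonal entry equal to 1. *)
Lemma possemidef_schur (R : realType) (N : nat) (M : 'M[R]_N) k0 :
  possemidef M -> M k0 k0 = 1 -> possemidef (M - col k0 M *m (col k0 M)^T).
Proof.
move=> [symM posM] M1; set v := col k0 M.
split; first by rewrite linearB /= symM trmx_mul trmxK.
move=> x; set t := (x^T *m v) 0 0.
have vx : v^T *m x = t%:M.
  by rewrite [LHS]mx11_scalar -[v^T *m x]trmxK trmx_mul trmxK mxE.
have e1 : M *m delta_mx k0 0 = v by rewrite -colE.
have e2 : (delta_mx k0 0)^T *m M = v^T by rewrite trmx_delta -rowE -{1}symM tr_col.
(* test the form of M at x - t e_k0, with t the inner product of v and x *)
have := posM (x - t *: delta_mx k0 0).
rewrite [(x - _)^T]linearB /= linearZ /= mulmxBl -scalemxAl e2 mulmxBr !mulmxBl.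
rewrite -!scalemxAr -!scalemxAl -[x^T *m M *m delta_mx _ _]mulmxA e1 vx.
have -> : v^T *m delta_mx k0 0 = 1%:M.
  by rewrite -colE [LHS]mx11_scalar !mxE M1.
rewrite mulmxBr mulmxBl [x^T *m (v *m _)]mulmxA -[x^T *m v *m _ *m _]mulmxA vx.
rewrite [x^T *m v]mx11_scalar -/t -scalar_mxM.
rewrite !mxE eqxx !mulr1n => h.
by apply: le_trans h _; rewrite le_eqVlt; apply/orP; left; apply/eqP; ring.
Qed.

(** For a positive semidefinite matrix with an entry 1 on the diagonal and trace at
    most |w|^2, the distance to w w^T is controlled linearly by the entrywise
    distance from the corresponding column to w. *)
Lemma near_rank_one (R : realType) (N : nat) (M : 'M[R]_N) (w : 'cV[R]_N) k0
    (E D : R) :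
  possemidef M -> M k0 k0 = 1 -> 0 <= E -> 0 <= D ->
  (forall k, `|w k 0| <= D) -> (forall k, `|M k k0 - w k 0| <= E) ->
  \tr M <= \sum_k w k 0 ^+ 2 ->
  frob (M - w *m w^T) <= 5%:R * E * N%:R * D.
Proof.
move=> psdM M1 E0 D0 wD vE trM.
set v := col k0 M; have vk k : v k 0 = M k k0 by rewrite mxE.
set A := M - v *m v^T; have psdA : possemidef A by apply: possemidef_schur.
have trA : \tr A = \tr M - \sum_k v k 0 ^+ 2.
  rewrite linearB; congr (_ - _); apply: eq_bigr => k _.
  by rewrite mxE big_ord1 [_^T _ _]mxE expr2.
have A0 : 0 <= \tr A by apply: le_trans (possemidef_frob_le_tr psdA); rewrite sqrtr_ge0.
have trAE : \tr A <= 2%:R * E * N%:R * D.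
  rewrite trA; apply: le_trans (_ : \sum_k (w k 0 ^+ 2 - v k 0 ^+ 2) <= _).
    by rewrite sumrB lerD2r.
  apply: le_trans (_ : \sum_(k < N) (2%:R * E * D) <= _); last first.
    by rewrite sumr_const card_ord -[_ *+ N]mulr_natr mulrAC.
  (* w^2 - v^2 <= 2 w (w - v) *)
  apply: ler_sum => k _; apply: le_trans (_ : 2%:R * (w k 0 * (w k 0 - v k 0)) <= _).
    by have := sqr_ge0 (w k 0 - v k 0); lra.
  rewrite -mulrA ler_pM2l // mulrC; apply: le_trans (ler_norm _) _.
  by rewrite normrM ler_pM // vk distrC.
have W0 (u : 'cV[R]_N) : 0 <= \sum_k u k 0 ^+ 2.
  by rewrite sumr_ge0 // => k _; rewrite sqr_ge0.
have wN : \sum_k w k 0 ^+ 2 <= N%:R * D ^+ 2.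
  rewrite mulr_natl -[N in _ *+ N]card_ord -sumr_const; apply: ler_sum => k _.
  by rewrite -[w k 0 ^+ 2]real_normK ?num_real // ler_pXn2r ?nnegrE.
have vN : \sum_k v k 0 ^+ 2 <= N%:R * D ^+ 2 by lra.
have dN : \sum_k (v k 0 - w k 0) ^+ 2 <= N%:R * E ^+ 2.
  rewrite mulr_natl -[N in _ *+ N]card_ord -sumr_const; apply: ler_sum => k _.
  by rewrite -[(_ - _) ^+ 2]real_normK ?num_real // ler_pXn2r ?nnegrE ?vk.
have B0 : 0 <= 5%:R * E * N%:R * D by rewrite !mulr_ge0.
rewrite -(ler_pXn2r (n := 2)) ?nnegrE ?sqrtr_ge0 // frob_sqr.
have prodE (f g : 'I_N -> R) :
  \sum_i \sum_j f i * g j = (\sum_i f i) * (\sum_j g j).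
  by rewrite mulr_suml; apply: eq_bigr => i _; rewrite mulr_sumr.
(* M - w w^T = A + (v - w) v^T + w (v - w)^T *)
apply: le_trans (_ : \sum_i \sum_j 3%:R * (A i j ^+ 2 +
    (v i 0 - w i 0) ^+ 2 * v j 0 ^+ 2 + w i 0 ^+ 2 * (v j 0 - w j 0) ^+ 2) <= _).
  apply: ler_sum => i _; apply: ler_sum => j _.
  have -> : (M - w *m w^T) i j =
      A i j + (v i 0 - w i 0) * v j 0 + w i 0 * (v j 0 - w j 0).
    by rewrite !mxE !big_ord1 !mxE; ring.
  rewrite -!exprMn.
  move: (A i j) (_ * v j 0) (w i 0 * _) => p q r.
  have := sqr_ge0 (p - q); have := sqr_ge0 (q - r); have := sqr_ge0 (r - p).
  by rewrite !expr2; lra.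
under eq_bigr do rewrite -mulr_sumr !big_split /=.
rewrite -mulr_sumr !big_split /= -frob_sqr !prodE.
have fA2 : frob A ^+ 2 <= (2%:R * E * N%:R * D) ^+ 2.
  rewrite ler_pXn2r ?nnegrE ?sqrtr_ge0 ?mulr_ge0 //.
  exact: le_trans (possemidef_frob_le_tr psdA) _.
have m1 : (\sum_k (v k 0 - w k 0) ^+ 2) * (\sum_k v k 0 ^+ 2)
    <= N%:R * E ^+ 2 * (N%:R * D ^+ 2).
  by apply: ler_pM => //; rewrite sumr_ge0 // => k _; rewrite sqr_ge0.
have m2 : (\sum_k w k 0 ^+ 2) * (\sum_k (v k 0 - w k 0) ^+ 2)
    <= N%:R * D ^+ 2 * (N%:R * E ^+ 2).
  by apply: ler_pM => //; rewrite sumr_ge0 // => k _; rewrite sqr_ge0.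
have := sqr_ge0 (E * N%:R * D).
have -> : (5%:R * E * N%:R * D) ^+ 2 = 25%:R * (E * N%:R * D) ^+ 2 by ring.
have := fA2; have -> : (2%:R * E * N%:R * D) ^+ 2 = 4%:R * (E * N%:R * D) ^+ 2 by ring.
move: m1; have -> : N%:R * E ^+ 2 * (N%:R * D ^+ 2) = (E * N%:R * D) ^+ 2 by ring.
move: m2; have -> : N%:R * D ^+ 2 * (N%:R * E ^+ 2) = (E * N%:R * D) ^+ 2 by ring.
by lra.
Qed.

(** * Moments and the monomials of the vertices *)

Lemma monomD (R : realType) (K : nat) (z : 'cV[R]_K) (alpha beta : 'X_{1..K}) :
  monom z (alpha + beta)%MM = monom z alpha * monom z beta.
Proof.
by rewrite /monom -big_split; apply: eq_bigr => k _; rewrite /= mnmDE exprD.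
Qed.

Lemma monom0 (R : realType) (K : nat) (z : 'cV[R]_K) : monom z 0%MM = 1.
Proof. by rewrite /monom big1 // => k _; rewrite mnm0E. Qed.

Lemma monomU (R : realType) (K : nat) (z : 'cV[R]_K) (k : 'I_K) :
  monom z U_(k)%MM = z k 0.
Proof.
rewrite /monom (bigD1 k) //= mnm1E eqxx expr1 big1 ?mulr1 // => l nlk.
by rewrite mnm1E eq_sym (negbTE nlk).
Qed.

(** The support of p may be replaced with any list containing it, which makes the
    linearity of [riesz] a termwise identity. *)
Lemma riesz_supset (R : realType) (K : nat) (M : mommx R K) (p : {mpoly R[K]})
    (s : seq 'X_{1..K}) :
  uniq s -> {subset msupp p <= s} ->
  riesz M p = \sum_(gamma <- s) p@_gamma * moment M gamma.
Proof.
move=> us sub; rewrite /riesz [RHS](bigID (mem (msupp p))) /=.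
rewrite [X in _ = _ + X]big1 ?addr0; last first.
  by move=> g /memN_msupp_eq0 ->; rewrite mul0r.
rewrite -[RHS]big_filter; apply: perm_big; apply: uniq_perm; rewrite ?filter_uniq //.
by move=> g; rewrite mem_filter /=; case: (boolP (g \in msupp p)) => // /sub ->.
Qed.

Lemma riesz_linear (R : realType) (K : nat) (M : mommx R K) (p q : {mpoly R[K]})
    (r : R) :
  riesz M (p - r *: q) = riesz M p - r * riesz M q.
Proof.
set s := undup (msupp p ++ msupp q ++ msupp (p - r *: q)).
have us : uniq s by rewrite undup_uniq.
rewrite !(@riesz_supset _ _ M _ s) //; try by
  move=> g gs; rewrite mem_undup !mem_cat gs ?orbT.
rewrite mulr_sumr -sumrB; apply: eq_bigr => g _.
by rewrite mcoeffB mcoeffZ mulrBl mulrA.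
Qed.

Lemma rieszX (R : realType) (K : nat) (M : mommx R K) (gamma : 'X_{1..K}) :
  riesz M 'X_[gamma] = moment M gamma.
Proof. by rewrite /riesz msuppX big_seq1 mcoeffX eqxx mul1r. Qed.

Lemma moment_ment (R : realType) (K : nat) (M : mommx R K)
    (alpha beta : 'X_{1..K < 3}) :
  structured M -> moment M (alpha + beta)%MM = ment M alpha beta.
Proof.
move=> sM; rewrite /moment; case: pickP => [p /eqP /sM //|].
by move/(_ (alpha, beta)); rewrite eqxx.
Qed.

Lemma moment_col0 (R : realType) (K : nat) (M : mommx R K)
    (alpha : 'X_{1..K < 3}) :
  structured M -> moment M alpha = ment M alpha bm0.
Proof. by move=> sM; rewrite -moment_ment //= addm0. Qed.

Lemma ment_mom0 (R : realType) (K : nat) (z : 'cV[R]_K)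
    (alpha beta : 'X_{1..K < 3}) :
  ment (mom0 z) alpha beta = monom z alpha * monom z beta.
Proof. by rewrite /ment /mom0 !mxE big_ord1 !mxE !enum_rankK. Qed.

Lemma structured_mom0 (R : realType) (K : nat) (z : 'cV[R]_K) :
  structured (mom0 z).
Proof. by move=> al be al' be' e; rewrite !ment_mom0 -!monomD e. Qed.

(** The vertices of the bipartite graph. *)
Notation vertex m n := ('I_m.+1 + 'I_n.+1)%type.

(** The monomial attached to a vertex: the variable that it carries, or the
    monomial 1 for row 1, whose coordinate is normalized to 1. *)
Definition vmon (m n : nat) (u : vertex m n) : 'X_{1..(m + n.+1)} :=
  match u with
  | inl i => if (unlift ord0 i : option 'I_m) is Some i'
             then U_(lshift n.+1 i')%MM else 0%MM
  | inr j => U_(rshift m j)%MM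
  end.

(** The coordinate of the rank-one factorization attached to a vertex. *)
Definition vcoord (R : realType) (m n : nat) (x : 'cV[R]_m.+1) (y : 'cV[R]_n.+1)
    (u : vertex m n) : R :=
  match u with inl i => x i 0 | inr j => y j 0 end.

Lemma mdeg_vmon (m n : nat) (u : vertex m n) : (mdeg (vmon u) <= 1)%N.
Proof.
case: u => [i|j] /=; last by rewrite mdeg1.
by case: unliftP => [i'|] _; rewrite ?mdeg1 ?mdeg0.
Qed.

Lemma monom_vmon (R : realType) (m n : nat) (x : 'cV[R]_m.+1) (y : 'cV[R]_n.+1)
    (u : vertex m n) :
  x ord0 0 = 1 -> monom (zvec x y) (vmon u) = vcoord x y u.
Proof.
move=> x1; case: u => [i|j] /=; last by rewrite monomU /zvec col_mxEd.
case: unliftP => [i' ->|->]; last by rewrite monom0 x1.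
by rewrite monomU /zvec col_mxEu mxE.
Qed.

Lemma mnm1_vmon (m n : nat) (k : 'I_(m + n.+1)) :
  exists u : vertex m n, vmon u = U_(k)%MM.
Proof.
rewrite -(splitK k); case: (split k) => [i|j] /=.
  by exists (inl (lift ord0 i)); rewrite /= liftK.
by exists (inr j).
Qed.

Lemma mdeg_le1_vmon (m n : nat) (alpha : 'X_{1..(m + n.+1)}) :
  (mdeg alpha <= 1)%N -> exists u : vertex m n, alpha = vmon u.
Proof.
rewrite leq_eqVlt ltnS leqn0 mdeg_eq0 => /orP[/mdeg1P[k /eqP ->]|/eqP ->].
  by have [u <-] := mnm1_vmon k; exists u.
by exists (inl ord0); rewrite /= unlift_none.
Qed.

(** Since row 1 carries the monomial 1, products of two vertex monomials exhaust
    the multi-indices of degree at most 2. *)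
Lemma mdeg_le2_vmon (m n : nat) (alpha : 'X_{1..(m + n.+1)}) :
  (mdeg alpha <= 2)%N -> exists u v : vertex m n, alpha = (vmon u + vmon v)%MM.
Proof.
move=> a2; have [k ak|a0] := pickP (fun k => 0 < alpha k)%N.
  have le1 : (U_(k) <= alpha)%MM.
    by apply/mnm_lepP => l; rewrite mnm1E; case: eqP => // <-.
  have [u uE] := mnm1_vmon k.
  have /mdeg_le1_vmon [v vE] : (mdeg (alpha - U_(k))%MM <= 1)%N.
    by move: a2; rewrite -{1}(submK le1) mdegD mdeg1 addn1.
  by exists u, v; rewrite uE -vE addmC submK.
exists (inl ord0), (inl ord0); rewrite /= unlift_none addm0.
by apply/mnmP => k; rewrite mnm0E; apply/eqP; rewrite -leqn0 leqNgt a0.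
Qed.

Lemma card_mnm_le2 (m n : nat) :
  (#|{: 'X_{1..(m + n.+1) < 3}}| <= (m.+1 + n.+1) ^ 2)%N.
Proof.
have cV : #|{: vertex m n * vertex m n}| = ((m.+1 + n.+1) ^ 2)%N.
  by rewrite card_prod card_sum !card_ord expnS expn1.
have deg2 (p : vertex m n * vertex m n) : (mdeg (vmon p.1 + vmon p.2)%MM < 3)%N.
  by rewrite mdegD ltnS (leq_add (mdeg_vmon _) (mdeg_vmon _)).
pose f p : 'X_{1..(m + n.+1) < 3} := BMultinom (deg2 p).
have -> : #|{: 'X_{1..(m + n.+1) < 3}}| = #|[set f p | p in setT]|.
  rewrite -cardsT; congr #|pred_of_set _|.
  apply/setP => al; rewrite inE; apply/esym/imsetP.
  have /mdeg_le2_vmon [u [v aE]] : (mdeg al <= 2)%N by rewrite -ltnS bmdeg.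
  by exists (u, v) => //; apply/val_inj.
by rewrite -cV -cardsT leq_imset_card.
Qed.

(** The constraint polynomial of an edge pairs to a difference of two moments. *)
Lemma riesz_hconstr (R : realType) (m n : nat) (X0 : 'M[R]_(m.+1, n.+1))
    (eps : 'I_m.+1 -> 'I_n.+1 -> R) (M : mommx R (m + n.+1)) i j
    (kappa : 'X_{1..(m + n.+1)}) :
  riesz M (hconstr X0 eps i j * 'X_[kappa]) =
    moment M (vmon (inl i) + vmon (inr j) + kappa)%MM
    - (X0 i j + eps i j) * moment M kappa.
Proof.
have -> : hconstr X0 eps i j * 'X_[kappa] =
    'X_[vmon (inl i) + vmon (inr j) + kappa] - (X0 i j + eps i j) *: 'X_[kappa].
  rewrite !mpolyXD /hconstr /=.
  rewrite -mul_mpolyC mpolyCD.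
  by case: unlift => [i'|]; rewrite ?mpolyX0; ring.
by rewrite riesz_linear !rieszX.
Qed.

(** * Propagation of the constraints along paths *)

(** A function that moves by at most B over two consecutive edges drifts by at
    most B times the length of a path; both ends of the edge before the path are needed
    to start the induction, whichever parity the length has. *)
Lemma path_two_step_bound (R : realType) (T : Type) (e : rel T) (g : T -> R) (t B : R) :
  0 <= B ->
  (forall u v w, e u v -> e v w -> `|g w - g u| <= B) ->
  forall (p : seq T) (x y : T) (s : R),
    e x y -> `|g x - t| <= s -> `|g y - t| <= s -> path e y p ->
    `|g (last y p) - t| <= s + (size p)%:R * B.
Proof.
move=> B0 step; elim=> [|w p IHp] x y s exy gx gy /=.
  by rewrite mul0r addr0.
move=> /andP[eyw pw]; rewrite -natr1 mulrDl mul1r [_ * B + B]addrC addrA.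
apply: (IHp y) => //; first by apply: le_trans gy _; rewrite lerDl.
have -> : g w - t = (g x - t) + (g w - g x) by ring.
by apply: le_trans (ler_normD _ _) (lerD gx (step _ _ _ exy eyw)).
Qed.

(** If mom nearly satisfies the edge relations in degree at most 4, then
    multiplying a monomial q of degree at most 1 by the monomial of any vertex
    nearly multiplies mom by the coordinate of that vertex. *)
Lemma moment_walk (R : realType) (m n : nat) (Omega : {set 'I_m.+1 * 'I_n.+1})
    (mom : 'X_{1..(m + n.+1)} -> R) (z : vertex m n -> R) (d D delta : R) :
  bip_connected Omega -> 0 < d -> (forall u, d <= `|z u| <= D) ->
  z (inl ord0) = 1 -> 0 <= delta ->
  (forall u v kappa, bip_edge Omega u v -> (mdeg kappa <= 2)%N ->
    `|mom (vmon u + vmon v + kappa)%MM - z u * z v * mom kappa| <= delta) ->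
  forall u q, (mdeg q <= 1)%N ->
    `|mom (vmon u + q)%MM - z u * mom q|
      <= D * ((m.+1 + n.+1)%:R * (2%:R * delta / d ^+ 3)).
Proof.
move=> conn d0 zdD z1 delta0 edge u q q1.
set B := _ / _; have B0 : 0 <= B by rewrite divr_ge0 ?mulr_ge0 ?exprn_ge0 // ltW.
have dz v : d <= `|z v| by case/andP: (zdD v).
have z0 v : z v != 0 by rewrite -normr_gt0; apply: lt_le_trans (dz v).
pose g v := mom (vmon v + q)%MM / z v.
have deg2 v : (mdeg (vmon v + q)%MM <= 2)%N by rewrite mdegD (leq_add (mdeg_vmon v) q1).
have step v1 v2 v3 :
    bip_edge Omega v1 v2 -> bip_edge Omega v2 v3 -> `|g v3 - g v1| <= B.
  move=> e12 e23.
  have h1 := edge _ _ _ e12 (deg2 v3); have h2 := edge _ _ _ e23 (deg2 v1).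
  (* the moment of v1 + v2 + v3 + q is reached from both edges *)
  have E : (vmon v1 + vmon v2 + (vmon v3 + q) = vmon v2 + vmon v3 + (vmon v1 + q))%MM.
    by apply/mnmP => k; rewrite !mnmDE; lia.
  have -> : g v3 - g v1 = (z v1 * z v2 * mom (vmon v3 + q)%MM -
      z v2 * z v3 * mom (vmon v1 + q)%MM) / (z v1 * z v2 * z v3).
    by rewrite /g; field; rewrite !z0.
  rewrite normrM normfV; apply: ler_pM; rewrite ?invr_ge0 //.
    move: h1 h2; rewrite E !ler_norml => /andP[a1 a2] /andP[a3 a4].
    by apply/andP; split; lra.
  rewrite lef_pV2 ?posrE ?normr_gt0 ?mulf_neq0 ?exprn_gt0 //.
  by rewrite !normrM !exprS expr0 mulr1 mulrA !ler_pM ?mulr_ge0 // ltW.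
(* a simple path from row 1 has at most m.+1 + n.+1 vertices *)
suff gu : `|g u - mom q| <= (m.+1 + n.+1)%:R * B.
  have -> : mom (vmon u + q)%MM - z u * mom q = z u * (g u - mom q).
    by rewrite /g; field.
  by rewrite normrM ler_pM //; case/andP: (zdD u).
have g0 : g (inl ord0) = mom q by rewrite /g z1 divr1 /= unlift_none add0m.
have /connectP[p0 pth0 ulast] := conn (inl ord0) u.
rewrite {}ulast; case/shortenP: pth0 => p pth up _.
have szp : (size p <= m.+1 + n.+1)%N.
  apply: leq_trans (_ : size (inl ord0 :: p) <= _)%N => //=.
  have := card_uniqP up => /= <-; rewrite -[leqRHS](_ : #|{: vertex m n}| = _).
    exact: max_card.
  by rewrite card_sum !card_ord.
case: p pth up szp => [|v p] /=.
  by move=> _ _ _; rewrite g0 subrr normr0 mulr_ge0.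
move=> /andP[e0v' pth] _ szp; have {e0v'} e0v : bip_edge Omega (inl ord0) v by [].
apply: le_trans (_ : B + (size p)%:R * B <= _); last first.
  by rewrite -{1}[B]mul1r -mulrDl nat1r ler_wpM2r // ler_nat.
apply: (path_two_step_bound B0 step e0v) => //.
  by rewrite g0 subrr normr0.
have d1 : d <= 1 by have := dz (inl ord0); rewrite z1 normr1.
(* the first edge leaves row 1 and gives the error at v directly *)
have := edge _ _ _ e0v (leqW q1); rewrite z1 mul1r /= unlift_none add0m => h.
have -> : g v - mom q = (mom (vmon v + q)%MM - z v * mom q) / z v by rewrite /g; field.
rewrite normrM normfV; apply: ler_pM; rewrite ?invr_ge0 //.
  by apply: le_trans h _; lra.
rewrite lef_pV2 ?posrE ?normr_gt0 ?exprn_gt0 //; apply: le_trans (dz v).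
by rewrite exprS -[leRHS]mulr1 ler_pM2l // expr_le1 // ltW.
Qed.

Lemma eps_le_noise_norm (R : realType) (m n : nat) (Omega : {set 'I_m * 'I_n})
    (eps : 'I_m -> 'I_n -> R) i j :
  (i, j) \in Omega -> `|eps i j| <= noise_norm Omega eps.
Proof.
move=> ij; rewrite -sqrtr_sqr; apply: ler_wsqrtr.
by rewrite (bigD1 (i, j)) //= lerDl sumr_ge0 // => p _; rewrite sqr_ge0.
Qed.

(** The edge relation satisfied by the moments of a feasible matrix, with the noise
    of the constraint moved to the error. *)
Lemma feasible_edge (R : realType) (m n : nat) (x : 'cV[R]_m.+1) (y : 'cV[R]_n.+1)
    (Omega : {set 'I_m.+1 * 'I_n.+1}) (eps : 'I_m.+1 -> 'I_n.+1 -> R)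
    (eta : R) (M : mommx R (m + n.+1)) (u v : vertex m n) (kappa : 'X_{1..(m + n.+1)}) :
  feasible (x *m y^T) Omega eps eta M -> bip_edge Omega u v -> (mdeg kappa <= 2)%N ->
  `|moment M (vmon u + vmon v + kappa)%MM
      - vcoord x y u * vcoord x y v * moment M kappa|
     <= eta + noise_norm Omega eps * `|moment M kappa|.
Proof.
move=> [_ _ _ res] euv k2.
wlog [i [j [uE vE]]] : u v euv / exists i j, u = inl i /\ v = inr j.
  move=> W; case: u v euv => [i|j] [i'|j'] //= euv.
    by apply: (W (inl i) (inr j')) => //; exists i, j'.
  rewrite [(vmon (inr _) + _)%MM]addmC [y j 0 * _]mulrC.
  by apply: (W (inl i') (inr j)) => //; exists i', j.
move: euv; rewrite uE vE /= => ij.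
pose kap : 'X_{1..(m + n.+1) < 3} := BMultinom (k2 : (mdeg kappa < 3)%N).
have Hr : `|riesz M (hconstr (x *m y^T) eps i j * 'X_[kappa])| <= eta.
  apply: le_trans res; rewrite -[leLHS]normr_id -sqrtr_sqr; apply: ler_wsqrtr.
  rewrite (bigD1 kap) //= (bigD1 (i, j)) //= -addrA lerDl addr_ge0 //.
    by rewrite sumr_ge0 // => p _; rewrite sqr_ge0.
  by rewrite sumr_ge0 // => al _; rewrite sumr_ge0 // => p _; rewrite sqr_ge0.
move: Hr; rewrite riesz_hconstr => Hr.
have -> : moment M (vmon (inl i) + vmon (inr j) + kappa)%MM
            - x i 0 * y j 0 * moment M kappa
  = (moment M (vmon (inl i) + vmon (inr j) + kappa)%MM
     - ((x *m y^T) i j + eps i j) * moment M kappa) + eps i j * moment M kappa.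
  by rewrite !mxE big_ord1 !mxE; ring.
apply: le_trans (ler_normD _ _) (lerD Hr _).
by rewrite normrM ler_wpM2r // eps_le_noise_norm.
Qed.

(** The rank-one moment matrix is feasible: its weighted residuals are those
    of the admissibility condition. *)
Lemma feasible_mom0 (R : realType) (m n : nat) (x : 'cV[R]_m.+1) (y : 'cV[R]_n.+1)
    (Omega : {set 'I_m.+1 * 'I_n.+1}) (eps : 'I_m.+1 -> 'I_n.+1 -> R) (c eta : R) :
  x ord0 0 = 1 -> 0 <= eta -> admissible Omega eps (zvec x y) c eta ->
  feasible (x *m y^T) Omega eps eta (mom0 (zvec x y)).
Proof.
move=> x1 eta0 [_ resid _]; split; first exact: possemidef_outer.
- exact: structured_mom0.
- by rewrite ment_mom0 monom0 mulr1.
rewrite -(ler_pXn2r (n := 2)) ?nnegrE ?sqrtr_ge0 // sqr_sqrtr; last first.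
  by rewrite sumr_ge0 // => al _; rewrite sumr_ge0 // => p _; rewrite sqr_ge0.
apply: le_trans resid; rewrite le_eqVlt; apply/orP; left; apply/eqP.
apply: eq_bigr => kappa _; apply: eq_bigr => -[i j] _ /=.
rewrite real_normK ?num_real // riesz_hconstr.
have d3 : (mdeg (vmon (inl i : vertex m n) + vmon (inr j : vertex m n))%MM < 3)%N.
  by rewrite mdegD ltnS (leq_add (mdeg_vmon _) (mdeg_vmon _)).
have st := structured_mom0 (zvec x y).
rewrite (moment_ment (BMultinom d3) kappa st) (moment_col0 kappa st) !ment_mom0.
rewrite [monom _ (BMultinom d3)]monomD !monom_vmon // monom0 /=.
by rewrite !mxE big_ord1 !mxE; ring.
Qed.

(** Entries of an entrywise bounded rank-one matrix bound its normalized factors. *)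
Lemma vcoord_bounds (R : realType) (m n : nat) (x : 'cV[R]_m.+1) (y : 'cV[R]_n.+1)
    (a b : R) (u : vertex m n) :
  0 < a -> a <= b -> (forall i j, a <= `|(x *m y^T) i j| <= b) -> x ord0 0 = 1 ->
  Num.min a (a / b) <= `|vcoord x y u| <= Num.max b (b / a).
Proof.
move=> a0 ab h x1; have b0 : 0 < b by apply: lt_le_trans ab.
have XE i j : (x *m y^T) i j = x i 0 * y j 0 by rewrite !mxE big_ord1 mxE.
have yb j : a <= `|y j 0| <= b by have := h ord0 j; rewrite XE x1 mul1r.
case: u => [i|j] /=; rewrite ge_min le_max; last by case/andP: (yb j) => -> ->.
have := h i ord0; rewrite XE normrM => /andP[h1 h2].
have /andP[y1 y2] := yb ord0.
apply/andP; split; apply/orP; right.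
  rewrite ler_pdivrMr //; apply: le_trans h1 _; exact: ler_wpM2l.
rewrite ler_pdivlMr //; apply: le_trans _ h2; exact: ler_wpM2l.
Qed.

(** * The error bound *)

Lemma monom_bounds (R : realType) (m n : nat) (x : 'cV[R]_m.+1) (y : 'cV[R]_n.+1)
    (d D : R) (alpha : 'X_{1..(m + n.+1)}) :
  x ord0 0 = 1 -> 0 <= d -> (forall u, d <= `|vcoord x y u| <= D) ->
  (mdeg alpha <= 2)%N -> d ^+ 2 <= `|monom (zvec x y) alpha| <= D ^+ 2.
Proof.
move=> x1 d0 zdD /mdeg_le2_vmon [u [v ->]].
have /andP[u1 u2] := zdD u; have /andP[v1 v2] := zdD v.
by rewrite monomD !monom_vmon // normrM !expr2 !ler_pM.
Qed.

(** Moments of degree at most 2 of a structured positive semidefinite matrix are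
    bounded by the square root of its trace. *)
Lemma moment_sqr_le_tr (R : realType) (K : nat) (M : mommx R K)
    (kappa : 'X_{1..K < 3}) :
  possemidef M -> structured M -> ment M bm0 bm0 = 1 ->
  moment M kappa ^+ 2 <= \tr M.
Proof.
move=> psdM st M1; rewrite moment_col0 //.
apply: le_trans (possemidef_sqr_le _ _ psdM) _.
rewrite [X in _ * X]M1 mulr1 /mxtrace (bigD1 (enum_rank kappa)) //= lerDl.
rewrite sumr_ge0 // => k _.
have := psdM.2 (delta_mx k 0).
by rewrite trmx_delta -rowE -colE !mxE.
Qed.

(** Moments of degree at most 2 are close to the monomials of z0, with an error
    linear in the noise: no smallness of the noise is needed. *)
Lemma moment_error (R : realType) (m n : nat) (x : 'cV[R]_m.+1) (y : 'cV[R]_n.+1)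
    (Omega : {set 'I_m.+1 * 'I_n.+1}) (eps : 'I_m.+1 -> 'I_n.+1 -> R)
    (eta d D T : R) (M : mommx R (m + n.+1)) (alpha : 'X_{1..(m + n.+1)}) :
  bip_connected Omega -> x ord0 0 = 1 -> 0 <= eta ->
  0 < d -> (forall u, d <= `|vcoord x y u| <= D) ->
  feasible (x *m y^T) Omega eps eta M ->
  (forall kappa, (mdeg kappa <= 2)%N -> `|moment M kappa| <= T) ->
  (mdeg alpha <= 2)%N ->
  `|moment M alpha - monom (zvec x y) alpha| <=
    4%:R * D ^+ 2 / d ^+ 3 * (m.+1 + n.+1)%:R * (eta + noise_norm Omega eps * T).
Proof.
move=> conn x1 eta0 d0 zdD feas MT /mdeg_le2_vmon [u [v ->]].
have [_ st M1 _] := feas.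
have nn0 : 0 <= noise_norm Omega eps by rewrite sqrtr_ge0.
have mom1 : moment M 0%MM = 1 by rewrite -M1 -(moment_col0 bm0 st).
have T0 : 0 <= T by apply: le_trans (MT 0%MM _); rewrite ?mdeg0.
set delta := eta + _; have delta0 : 0 <= delta by rewrite addr_ge0 ?mulr_ge0.
have walk w q : (mdeg q <= 1)%N ->
    `|moment M (vmon w + q)%MM - vcoord x y w * moment M q|
      <= D * ((m.+1 + n.+1)%:R * (2%:R * delta / d ^+ 3)).
  apply: (@moment_walk R m n Omega) => //.
  move=> w1 w2 kappa e12 k2; apply: le_trans (feasible_edge feas e12 k2) _.
  by rewrite lerD2l ler_wpM2l // MT.
set E1 := D * _ in walk.
rewrite monomD !monom_vmon //.
have h1 := walk u _ (mdeg_vmon v).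
have := walk v 0%MM; rewrite mdeg0 addm0 mom1 mulr1 => /(_ isT) h2.
have -> : 4%:R * D ^+ 2 / d ^+ 3 * (m.+1 + n.+1)%:R * delta = 2%:R * D * E1.
  by rewrite /E1; field; rewrite lt0r_neq0.
have /andP[u1 u2] := zdD u.
have D1 : 1 <= D by have /andP[_] := zdD (inl ord0); rewrite /= x1 normr1.
have E10 : 0 <= E1 by apply: le_trans h2.
have -> : moment M (vmon u + vmon v)%MM - vcoord x y u * vcoord x y v =
  (moment M (vmon u + vmon v)%MM - vcoord x y u * moment M (vmon v)) +
  vcoord x y u * (moment M (vmon v) - vcoord x y v) by ring.
apply: le_trans (ler_normD _ _) _; rewrite normrM.
have h3 : `|vcoord x y u| * `|moment M (vmon v) - vcoord x y v| <= D * E1.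
  by rewrite ler_pM.
have : 1 * E1 <= D * E1 by rewrite ler_wpM2r.
by move: h1; lra.
Qed.

Theorem theorem2 (R : realType) (a b c : R) (a_gt0 : 0 < a) (le_ab : a <= b)
    (c_gt0 : 0 < c) :
  exists C0 : R,
    forall (m n : nat) (X0 : 'M[R]_(m.+1, n.+1))
      (x0 : 'cV[R]_m.+1) (y0 : 'cV[R]_n.+1)
      (Omega : {set 'I_m.+1 * 'I_n.+1})
      (eps : 'I_m.+1 -> 'I_n.+1 -> R) (eta : R)
      (M : 'M[R]_#|{: 'X_{1..(m + n.+1) < 3}}|),
    \rank X0 = 1%N ->
    (forall i j, a <= `|X0 i j| <= b) ->
    X0 = x0 *m y0^T ->
    x0 ord0 ord0 = 1 ->
    bip_connected Omega ->
    0 <= eta ->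
    admissible Omega eps (zvec x0 y0) c eta ->
    sdp_optimal X0 Omega eps eta M ->
    frob (M - mom0 (zvec x0 y0)) / frob (mom0 (zvec x0 y0))
      <= C0 * Num.sqrt ((m.+1 + n.+1)%:R ^+ 7) * noise_norm Omega eps.
Proof.
pose d := Num.min a (a / b); pose D := Num.max b (b / a).
have b_gt0 : 0 < b by apply: lt_le_trans le_ab.
have d0 : 0 < d by rewrite lt_min a_gt0 divr_gt0.
have D0 : 0 < D by rewrite lt_max b_gt0.
exists (20%:R * D ^+ 4 * (c + D ^+ 2) / d ^+ 7).
move=> m n X0 x y Omega eps eta M _ Xab XE x1 conn eta0 adm [feas opt].
rewrite {X0}XE in Xab feas opt.
have zdD u : d <= `|vcoord x y u| <= D by apply: vcoord_bounds.
have [psdM st M1 _] := feas; have [_ _ etac] := adm.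
set z := zvec x y; set nn := noise_norm _ _ in etac *.
have nn0 : 0 <= nn by rewrite sqrtr_ge0.
set N : R := _%:R in etac *.
have N1 : 1 <= N by rewrite ler1n addSn.
have N0 : 0 <= N by apply: le_trans N1.
(* the size P of M cancels in the final ratio; its bound N^2 serves for MT only *)
pose P := #|{: 'X_{1..(m + n.+1) < 3}}|.
have P0 : 0 < P%:R :> R by rewrite ltr0n; apply/card_gt0P; exists bm0.
have PN : P%:R <= N ^+ 2 by rewrite -natrX ler_nat card_mnm_le2.
have al2 (al : 'X_{1..(m + n.+1) < 3}) : (mdeg al <= 2)%N by rewrite -ltnS bmdeg.
have zb (k : 'I_P) : d ^+ 2 <= `|momvec z k 0| <= D ^+ 2.
  by rewrite mxE (monom_bounds _ _ zdD) ?ltW.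
have sqb (k : 'I_P) : d ^+ 4 <= momvec z k 0 ^+ 2 <= D ^+ 4.
  have /andP[k1 k2] := zb k; rewrite -[momvec z k 0 ^+ 2]real_normK ?num_real //.
  rewrite -[4%N]/(2 * 2)%N !exprM.
  by rewrite !ler_pXn2r ?nnegrE ?exprn_ge0 ?k1 ?(ltW d0) ?(ltW D0).
set w := momvec z in zb sqb *.
have trM : \tr M <= \sum_k w k 0 ^+ 2.
  apply: le_trans (opt _ (feasible_mom0 x1 eta0 adm)) _.
  rewrite le_eqVlt; apply/orP; left; apply/eqP; apply: eq_bigr => k _.
  by rewrite /mom0 mxE big_ord1 [_^T _ _]mxE expr2.
have w2le : \sum_k w k 0 ^+ 2 <= P%:R * D ^+ 4.
  rewrite mulr_natl -[P in _ *+ P]card_ord -sumr_const; apply: ler_sum => k _.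
  by case/andP: (sqb k).
have w2ge : P%:R * d ^+ 4 <= \sum_k w k 0 ^+ 2.
  rewrite mulr_natl -[P in _ *+ P]card_ord -sumr_const; apply: ler_sum => k _.
  by case/andP: (sqb k).
have MT kappa : (mdeg kappa <= 2)%N -> `|moment M kappa| <= N * D ^+ 2.
  move=> k2; pose kap : 'X_{1..(m + n.+1) < 3} := BMultinom (k2 : (mdeg kappa < 3)%N).
  have := moment_sqr_le_tr kap psdM st M1; rewrite /= => h.
  have D20 : 0 <= N * D ^+ 2 by rewrite mulr_ge0 // exprn_ge0 // ltW.
  rewrite -(ler_pXn2r (n := 2)) ?nnegrE // real_normK ?num_real //.
  apply: le_trans h _; apply: le_trans trM _; apply: le_trans w2le _.
  by rewrite exprMn -exprM ler_wpM2r // exprn_ge0 // ltW.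
set E := 4%:R * D ^+ 2 / d ^+ 3 * N * (eta + nn * (N * D ^+ 2)).
have E0 : 0 <= E by rewrite !(mulr_ge0, addr_ge0, invr_ge0, exprn_ge0) // ltW.
have vE (k : 'I_P) : `|M k (enum_rank bm0) - w k 0| <= E.
  have := moment_error conn x1 eta0 d0 zdD feas MT (al2 (enum_val k)).
  by rewrite moment_col0 // /ment enum_valK [w k 0]mxE.
have D20 : 0 <= D ^+ 2 by rewrite exprn_ge0 // ltW.
have wD k : `|w k 0| <= D ^+ 2 by case/andP: (zb k).
have := near_rank_one psdM M1 E0 D20 wD vE trM; rewrite -/(mom0 z) => near.
have den0 : 0 < P%:R * d ^+ 4 by rewrite mulr_gt0 // exprn_gt0.
rewrite /mom0 frob_outer -/(mom0 z) -/w.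
apply: le_trans (_ : 5%:R * E * P%:R * D ^+ 2 / (P%:R * d ^+ 4) <= _).
  apply: ler_pM; rewrite ?sqrtr_ge0 ?invr_ge0 //.
    by apply: le_trans w2ge; rewrite ltW.
  by rewrite lef_pV2 // posrE; apply: lt_le_trans w2ge.
have EN : E <= 4%:R * D ^+ 2 / d ^+ 3 * (c + D ^+ 2) * (N ^+ 2 * nn).
  have -> : 4%:R * D ^+ 2 / d ^+ 3 * (c + D ^+ 2) * (N ^+ 2 * nn) =
     4%:R * D ^+ 2 / d ^+ 3 * N * (c * N * nn + nn * (N * D ^+ 2)) by ring.
  by rewrite /E ler_wpM2l ?lerD2r // !(mulr_ge0, invr_ge0, exprn_ge0) // ltW.
have NS : N ^+ 2 <= Num.sqrt (N ^+ 7).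
  rewrite -[leLHS]ger0_norm ?exprn_ge0 // -sqrtr_sqr ler_wsqrtr // -exprM.
  by rewrite ler_weXn2l.
have -> : 5%:R * E * P%:R * D ^+ 2 / (P%:R * d ^+ 4) = 5%:R * D ^+ 2 / d ^+ 4 * E.
  by field; rewrite !lt0r_neq0.
have -> : 20%:R * D ^+ 4 * (c + D ^+ 2) / d ^+ 7 * Num.sqrt (N ^+ 7) * nn =
   5%:R * D ^+ 2 / d ^+ 4 *
     (4%:R * D ^+ 2 / d ^+ 3 * (c + D ^+ 2) * (Num.sqrt (N ^+ 7) * nn)).
  by field; rewrite lt0r_neq0.
have c0 := ltW c_gt0; have {}d0 := ltW d0; have {}D0 := ltW D0.
apply: ler_wpM2l; first by rewrite !(mulr_ge0, invr_ge0, exprn_ge0).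
apply: le_trans EN _; apply: ler_wpM2l; last exact: ler_wpM2r.
by rewrite !(mulr_ge0, invr_ge0, exprn_ge0, addr_ge0).
Qed.
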